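(* Let $G=(V,E)$ be a finite simple connected $4$-valent graph (every vertex has degree $4$). Then the rank $r(G)$ of its generic planar rigidity matroid satisfies $$r(G)\geq \frac{8}{5}|V|-1.$$
   Context: All graphs are finite and simple. For a graph $G=(V,E)$ and a map $\mathbf{p}:V\to\mathbb{R}^2$ (a planar realization, or configuration), the rigidity matrix $R(\mathbf{p})$ is the $|E|\times 2|V|$ real matrix whose row indexed by an edge $e_{ij}$ joining $v_i$ and $v_j$ has $\mathbf{p}(v_i)-\mathbf{p}(v_j)$ in the two columns belonging to $v_i$, $\mathbf{p}(v_j)-\mathbf{p}(v_i)$ in the two columns belonging to $v_j$, and $0$ elsewhere. Its rank is denoted $r(G(\mathbf{p}))$. When $\mathbf{p}$ is generic (for instance, the $2|V|$ coordinates of the points $\mathbf{p}(v)$ are algebraically independent over $\mathbb{Q}$), the rank does not depend on $\mathbf{p}$; this common value is denoted $r(G)$ and is the rank of the generic rigidity matroid of $G$. *)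

(* Defs.v *)
From HB Require Import structures.
From mathcomp Require Import all_boot all_order all_algebra.
From mathcomp Require Import reals mpoly.

Set Implicit Arguments.
Unset Strict Implicit.
Unset Printing Implicit Defensive.

Import GRing.Theory Num.Theory.
Local Open Scope ring_scope.

Section Graphs.
Variables (V : finType) (e : rel V).

Definition simple_graph : Prop := ssrbool.symmetric e /\ irreflexive e.

Definition connected_graph : Prop := forall x y : V, connect e x y.

Definition valent (d : nat) : Prop := forall x : V, #|[set y | e x y]| = d.

Definition edges : {set {set V}} :=
  [set A | [exists x, exists y, e x y && (A == [set x; y])]].

End Graphs.

Section Rigidity.
Variables (R : realType) (V : finType) (e : rel V).

(* Rows follow the enumeration of the edges, columns that of the pairs
   (vertex, coordinate).  For an edge A = {v, w} the inner sum has the single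
   index w, so the entry in column (v, k) is the k-th coordinate of p v - p w;
   no orientation of the edges has to be chosen. *)
Definition rigidity_matrix (p : V -> 'rV[R]_2) :
    'M[R]_(#|edges e|, #|{: V * 'I_2}|) :=
  \matrix_(a, c)
    let A : {set V} := enum_val a in
    let v := (enum_val c).1 in
    let k := (enum_val c).2 in
    if v \in A then \sum_(w in A :\ v) (p v - p w) 0 k else 0.

Definition rigidity_rank (p : V -> 'rV[R]_2) : nat := \rank (rigidity_matrix p).

End Rigidity.

Definition algebraically_independent_over_rat (R : realType) (I : finType)
    (x : I -> R) : Prop :=
  forall q : {mpoly rat[#|I|]},
    mmap (ratr : rat -> R) (fun i => x (enum_val i)) q = 0 -> q = 0.

Definition generic (R : realType) (V : finType) (p : V -> 'rV[R]_2) : Prop :=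
  algebraically_independent_over_rat (fun c : V * 'I_2 => p c.1 0 c.2).

(* Main.v *)
Require Import Defs.
From mathcomp Require Import all_boot all_order all_algebra.
From mathcomp Require Import reals mpoly zify ring lra.
Import GRing.Theory Num.Theory.
Local Open Scope ring_scope.

(** Call a set F of edges sparse when every vertex set X with at least two
    elements spans at most 2|X| - 3 edges of F, and call X tight when it spans
    exactly that many.  The proof has two halves.

    Sparse sets are independent in the generic rigidity matroid (the hard half
    of Laman's theorem, [sparse_independent]).  A nonempty sparse set has a
    vertex v of degree 1, 2 or 3.  Removing a vertex of degree at most 2 removes
    edges whose rows are visibly independent of the others ([zero_extension]).
    If v has degree 3, two of its neighbours a, b can be joined by a new edge so
    that F - v + ab is still sparse ([sparse_one_reduction]), and placing v at
    the midpoint of ab turns a stress of F into a stress of F - v + ab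
    ([one_extension]).  The midpoint is not a generic place, but some minor of
    the rigidity matrix is nonzero there; this minor is a nonzero polynomial in
    the coordinates, so it is nonzero at every generic configuration
    ([generic_rank]).

    It remains to find a sparse set of at least 8/5 |V| - 1 edges.  Let F be a
    maximal sparse subset of the edge set E.  By maximality every edge of E lies
    in a tight set, and tight sets sharing two vertices have a tight union, so
    each edge lies in exactly one maximal tight set, or block; hence |F| is the
    sum of 2|X| - 3 over the blocks X.  If V itself is a block, then
    |F| = 2|V| - 3 is large enough, as |V| >= 5.  Otherwise each block X gives
    each of its vertices the amount charge(d)/10, where d is the number of
    neighbours of that vertex inside X.  The four edges at a vertex bring it at
    least 8/5 in total ([charge_vertex]).  A block never spends more than its
    2|X| - 3 ([charge_block]), since by connectedness one of its vertices has a
    neighbour outside; the extreme case is K5 minus an edge. *)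

(** * Edge sets and sparsity *)

(* The types of edge sets contain reversed coercions, which would make
   convertible cardinals distinct atoms for lia. *)
Ltac card_lia :=
  intros; unfold reverse_coercion in *; simpl Finite.sort in *; lia.

Section EdgeSets.
Set Implicit Arguments.
Unset Strict Implicit.
Local Open Scope nat_scope.
Variable V : finType.
Implicit Types (F : {set {set V}}) (A X Y Z T : {set V}) (v w : V).

Definition two_uniform F := forall A, A \in F -> #|A| = 2.
Definition induced F X := [set A in F | A \subset X].
Definition star F v := [set A in F | v \in A].
Definition delete_vertex F v := [set A in F | v \notin A].
Definition degree F v := #|star F v|.
Definition neighbours F v := [set w | (w != v) && ([set v; w] \in F)].

Lemma star_neighbours F v : two_uniform F ->
  star F v = [set [set v; w] | w in neighbours F v].
Proof.
move=> F2; apply/setP=> A; rewrite inE; apply/andP/imsetP.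
  case=> AF vA; have /eqP/cards2P[x [y [xy EA]]] := F2 _ AF.
  move: vA; rewrite EA !inE => /orP[]/eqP ->.
    by exists y; rewrite // inE eq_sym xy -EA.
  by exists x; rewrite 1?setUC // inE xy setUC -EA.
by move=> [w]; rewrite inE => /andP[wv AF] ->; rewrite AF !inE eqxx.
Qed.

Lemma pair_inj v w x : w != v -> x != v -> [set v; w] = [set v; x] -> w = x.
Proof.
move=> wv xv /setP/(_ w); rewrite !inE eqxx (negPf wv) /= => /esym/eqP //.
Qed.

Lemma degree_neighbours F v : two_uniform F -> degree F v = #|neighbours F v|.
Proof.
move=> F2; rewrite /degree star_neighbours // card_in_imset // => x y.
rewrite !inE => /andP[xv _] /andP[yv _]; exact: pair_inj.
Qed.

Lemma sum_degree F X : \sum_(v in X) degree F v = \sum_(A in F) #|A :&: X|.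
Proof.
transitivity (\sum_(v in X) \sum_(A in F) (v \in A)).
  apply: eq_bigr => v _; rewrite /degree -sum1_card big_mkcond [RHS]big_mkcond.
  by apply: eq_bigr => A _; rewrite inE; case: (A \in F); case: (v \in A).
rewrite exchange_big; apply: eq_bigr => A _ /=.
rewrite -sum1_card big_mkcond [RHS]big_mkcond.
by apply: eq_bigr => v _; rewrite inE; case: (v \in A); case: (v \in X).
Qed.

(** Besides counting, the parity of the left-hand side is used: it decides the
    blocks with six vertices. *)
Lemma handshake F X : two_uniform F -> 
  \sum_(v in X) degree (induced F X) v = 2 * #|induced F X|.
Proof.
move=> F2; rewrite sum_degree mulnC -sum_nat_const; apply: eq_bigr => A.
by rewrite inE => /andP[AF /setIidPl ->]; apply: F2.
Qed.

Lemma inducedS F X Y : X \subset Y -> induced F X \subset induced F Y.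
Proof.
move=> XY; apply/subsetP=> A; rewrite !inE => /andP[-> AX] /=.
exact: subset_trans AX XY.
Qed.

Lemma inducedI F X Y :
  induced F X :&: induced F Y = induced F (X :&: Y).
Proof. by apply/setP=> A; rewrite !inE subsetI; case: (A \in F). Qed.

Lemma card_induced_supermodular F X Y :
  #|induced F X| + #|induced F Y| <=
  #|induced F (X :|: Y)| + #|induced F (X :&: Y)|.
Proof.
rewrite -cardsUI inducedI leq_add2r subset_leq_card // subUset.
by rewrite !inducedS ?subsetUl ?subsetUr.
Qed.

Lemma card_induced1 F X : two_uniform F -> #|X| <= 1 -> #|induced F X| = 0.
Proof.
move=> F2 X1; apply/eqP; rewrite cards_eq0; apply/eqP/setP=> A; rewrite !inE.
apply/negP=> /andP[AF /subset_leq_card]; rewrite F2 //; card_lia.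
Qed.

Lemma induced_pair F v w : two_uniform F -> v != w -> [set v; w] \in F ->
  #|induced F [set v; w]| = 1.
Proof.
move=> F2 vw vwF; rewrite (_ : induced _ _ = [set [set v; w]]) ?cards1 //.
apply/setP=> A; rewrite !inE; apply/andP/eqP=> [[AF Avw]|->]; last by [].
by apply/eqP; rewrite eqEcard Avw (F2 _ AF) cards2 vw.
Qed.

(** The independent sets of the (2,3)-count matroid: a framework on X has
    2|X| degrees of freedom, three of which are rigid motions of the plane. *)
Definition sparse F :=
  two_uniform F /\ forall X, 1 < #|X| -> #|induced F X| + 3 <= 2 * #|X|.
Definition tight F X := (1 < #|X|) && (#|induced F X| + 3 == 2 * #|X|).

Lemma sparse_sub F F' : F' \subset F -> sparse F -> sparse F'.
Proof.
move=> sF [F2 Fs]; split=> [A /(subsetP sF)|X X1]; first exact: F2.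
apply: leq_trans (Fs X X1); rewrite leq_add2r subset_leq_card //.
by apply/subsetP=> A; rewrite !inE => /andP[/(subsetP sF) -> ->].
Qed.

(** The intersection spans at most its share, so by supermodularity the union
    spans at least its share.  Two common vertices are needed because sparsity
    says nothing about smaller intersections. *)
Lemma tight_setU F X Y : sparse F -> tight F X -> tight F Y ->
  1 < #|X :&: Y| -> tight F (X :|: Y).
Proof.
move=> [F2 Fs] /andP[X1 /eqP tX] /andP[Y1 /eqP tY] XY.
have XUY : 1 < #|X :|: Y|.
  by apply: leq_trans X1 (subset_leq_card _); apply: subsetUl.
have := Fs _ XY; have := Fs _ XUY; have := card_induced_supermodular F X Y.
have := cardsUI X Y; rewrite /tight XUY /=; card_lia.
Qed.

Lemma tight_pair F v w : sparse F -> v != w -> [set v; w] \in F ->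
  tight F [set v; w].
Proof. by move=> [F2 _] vw vwF; rewrite /tight cards2 vw induced_pair. Qed.

(** The only obstruction to adding an edge is a set that already spans as many
    edges as it may.  An edge already present is its own obstruction. *)
Lemma sparse_setU1_or_tight F v w : sparse F -> v != w ->
  ([set v; w] \notin F /\ sparse ([set v; w] |: F)) \/
  exists X, [/\ tight F X, v \in X & w \in X].
Proof.
move=> sF vw; have [F2 Fs] := sF.
have [vwF|vwF] := boolP ([set v; w] \in F).
  by right; exists [set v; w]; rewrite tight_pair // !inE !eqxx orbT.
have [/existsP[X /and3P[tX vX wX]]|nX] :=
  boolP [exists X, [&& tight F X, v \in X & w \in X]].
  by right; exists X.
left; split=> //; split=> [A|X X1].
  by rewrite !inE => /orP[/eqP ->|/F2 //]; rewrite cards2 vw.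
have Xle := Fs _ X1.
have sub : induced ([set v; w] |: F) X \subset
    if (v \in X) && (w \in X) then [set v; w] |: induced F X else induced F X.
  apply/subsetP=> A; rewrite !inE => /andP[/orP[/eqP ->|AF] AX].
    by move: AX; rewrite subUset !sub1set => ->; rewrite !inE eqxx.
  by case: ifP => _; rewrite !inE AF AX ?orbT.
have := subset_leq_card sub; case: ifP => [/andP[vX wX] le|_]; last card_lia.
have := cardsU1 [set v; w] (induced F X).
have : ~~ tight F X.
  by apply: contra nX => tX; apply/existsP; exists X; rewrite tX vX.
rewrite /tight X1 /=; card_lia.
Qed.

(** If two of the three sets share two vertices, their union will do.
    Otherwise they meet pairwise in the single points a, b, c, span disjoint sets
    of edges, and the count of the whole union is
    2(|X| + |Y| + |Z|) - 9 = 2(|X| + |Y| + |Z| - 3) - 3. *)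
Lemma tight_triangle F X Y Z a b c : sparse F ->
  a != b -> a != c -> b != c ->
  tight F X -> tight F Y -> tight F Z ->
  a \in X -> b \in X -> a \in Y -> c \in Y -> b \in Z -> c \in Z ->
  exists T, [/\ tight F T, a \in T, b \in T & c \in T].
Proof.
move=> sF ab ac bc tX tY tZ aX bX aY cY bZ cZ.
have two (S : {set V}) u v : u != v -> u \in S -> v \in S -> 1 < #|S|.
  by move=> uv uS vS; apply/card_gt1P; exists u, v; split.
have [XY|XY] := ltnP 1 #|X :&: Y|.
  by exists (X :|: Y); rewrite tight_setU // !inE ?aX ?bX ?cY ?orbT.
have [XZ|XZ] := ltnP 1 #|X :&: Z|.
  by exists (X :|: Z); rewrite tight_setU // !inE ?aX ?bX ?cZ ?orbT.
have [YZ|YZ] := ltnP 1 #|Y :&: Z|.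
  by exists (Y :|: Z); rewrite tight_setU // !inE ?aY ?bZ ?cY ?orbT.
exists (X :|: Y :|: Z); rewrite !inE aX bX cY !orbT; split=> //.
have [F2 Fs] := sF.
move: tX tY tZ => /andP[X1 /eqP tX] /andP[Y1 /eqP tY] /andP[Z1 /eqP tZ].
have UZ : 1 < #|X :|: Y :|: Z| by apply: (two _ a b ab); rewrite !inE ?aX ?bX.
rewrite /tight UZ /=.
have XY1 : 0 < #|X :&: Y| by apply/card_gt0P; exists a; rewrite inE aX.
have I2 : 1 < #|(X :|: Y) :&: Z|.
  by apply: (two _ b c bc); rewrite !inE ?bX ?bZ ?cY ?cZ ?orbT.
have I2' : #|(X :|: Y) :&: Z| <= #|X :&: Z| + #|Y :&: Z|.
  by rewrite setIUl cardsU leq_subr.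
have sub : induced F X :|: induced F Y :|: induced F Z
           \subset induced F (X :|: Y :|: Z).
  by rewrite !subUset !inducedS // ?subsetUr // -?setUA ?subsetUl //
     setUCA subsetUl.
have := subset_leq_card sub; have := Fs _ UZ.
have IXY : #|induced F X :&: induced F Y| = 0.
  by rewrite inducedI card_induced1.
have IZ : #|(induced F X :|: induced F Y) :&: induced F Z| = 0.
  apply/eqP; rewrite setIUl !inducedI -leqn0.
  by rewrite (leq_trans (leq_card_setU _ _)) // !card_induced1.
have := cardsUI (induced F X) (induced F Y); rewrite IXY.
have := cardsUI (induced F X :|: induced F Y) (induced F Z); rewrite IZ.
have := cardsUI X Y; have := cardsUI (X :|: Y) Z; card_lia.
Qed.

(** Adding v to such a set would bring three edges but only two degrees of
    freedom. *)
Lemma no_tight_set_around_star F v T : sparse F -> degree F v = 3 ->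
  neighbours F v \subset T -> ~~ tight (delete_vertex F v) T.
Proof.
move=> [F2 Fs] d3 NT; apply/negP=> /andP[T1 /eqP tT].
have TvT : #|v |: T| <= #|T|.+1 by rewrite cardsU1; case: (_ \notin _).
have Tv1 : 1 < #|v |: T| by rewrite (leq_trans T1) // subset_leq_card ?subsetUr.
have sub : induced (delete_vertex F v) T :|: star F v
           \subset induced F (v |: T).
  apply/subsetP=> A; rewrite in_setU => /orP[].
    rewrite !inE => /andP[/andP[-> _] /subset_trans ->] //; exact: subsetUr.
  move=> Av; move: (Av); rewrite star_neighbours // => /imsetP[w wN EA].
  move: Av; rewrite !inE => /andP[-> _]; rewrite EA setUS //.
  by rewrite sub1set (subsetP NT).
have disj : induced (delete_vertex F v) T :&: star F v = set0.
  by apply/setP=> A; rewrite !inE; case: (v \in A); rewrite ?andbF.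
have := cardsUI (induced (delete_vertex F v) T) (star F v).
have := subset_leq_card sub; have := Fs _ Tv1.
rewrite disj cards0; move: d3; rewrite /degree; card_lia.
Qed.

(** If no pair of neighbours could be joined, each pair would lie in a tight
    set of F - v, and the triangle of these sets would produce a tight set around
    all three neighbours. *)
Lemma sparse_one_reduction F v : sparse F -> degree F v = 3 ->
  exists a b c, [/\ neighbours F v = [set a; b; c],
    [&& a != b, a != c & b != c],
    [set a; b] \notin delete_vertex F v &
    sparse ([set a; b] |: delete_vertex F v)].
Proof.
move=> sF d3; have [F2 _] := sF.
have N3 : #|neighbours F v| = 3 by rewrite -degree_neighbours.
have /card_gt2P[a [b [c [[aN bN cN] [ab bc ca]]]]] : 2 < #|neighbours F v|.
  by rewrite N3.
have ac : a != c by rewrite eq_sym.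
have EN : neighbours F v = [set a; b; c].
  apply/esym/eqP; rewrite eqEcard N3 -setUA !subUset !sub1set aN bN cN /=.
  by rewrite !cardsU1 cards1 !inE negb_or ab ac bc.
have sH : sparse (delete_vertex F v).
  by apply: sparse_sub sF; apply/subsetP=> A; rewrite inE => /andP[].
have [[? ?]|[X [tX aX bX]]] := sparse_setU1_or_tight sH ab.
  by exists a, b, c; rewrite ab ac bc.
have [[? ?]|[Y [tY aY cY]]] := sparse_setU1_or_tight sH ac.
  by exists a, c, b; rewrite ab ac (eq_sym c b) bc EN setUAC.
have [[? ?]|[Z [tZ bZ cZ]]] := sparse_setU1_or_tight sH bc.
  exists b, c, a; rewrite bc ca (eq_sym b a) ab EN; split=> //.
  by rewrite -setUA setUC.
have [T [tT aT bT cT]] := tight_triangle sH ab ac bc tX tY tZ aX bX aY cY bZ cZ.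
have NT : neighbours F v \subset T by rewrite EN !subUset !sub1set aT bT.
by have := no_tight_set_around_star sF d3 NT; rewrite tT.
Qed.

(** Fewer than 2|X| edges on X give average degree below 4. *)
Lemma sparse_low_degree F : sparse F -> F != set0 ->
  exists v, 0 < degree F v <= 3.
Proof.
move=> [F2 Fs] /set0Pn[A AF].
have sub : A \subset cover F by apply: bigcup_sup.
have c1 : 1 < #|cover F|.
  by apply: leq_trans (subset_leq_card sub); rewrite F2.
have IF : induced F (cover F) = F.
  apply/setP=> B; rewrite inE; case BF: (B \in F) => //=.
  by apply: bigcup_sup.
have H := handshake (cover F) F2; rewrite IF in H.
have := Fs _ c1; rewrite IF => le.
have [/existsP[v /andP[vc d]]|] := boolP [exists v in cover F, degree F v <= 3].
  exists v; rewrite d andbT; case/bigcupP: vc => B BF vB.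
  by apply/card_gt0P; exists B; rewrite inE BF.
rewrite negb_exists => /forallP all4.
suff : 4 * #|cover F| <= \sum_(v in cover F) degree F v by card_lia.
rewrite mulnC -sum_nat_const; apply: leq_sum => v vc.
by have := all4 v; rewrite vc -ltnNge.
Qed.

(** * Blocks of a maximal sparse set *)

(** Edges are added greedily, until each remaining edge is obstructed by a tight
    set. *)
Lemma exists_spanning_sparse E F : two_uniform E -> F \subset E -> sparse F ->
  exists F', [/\ F' \subset E, sparse F' &
    forall A, A \in E -> exists2 X, tight F' X & A \subset X].
Proof.
move=> E2; have [n] := ubnP (#|E| - #|F|); elim: n F => // n IHn F lt_n FE sF.
have [/'forall_implyP H|] :=
    boolP [forall A in E, [exists X, tight F X && (A \subset X)]].
  exists F; split=> // A /H /existsP[X /andP[tX AX]]; by exists X.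
rewrite negb_forall => /existsP[A]; rewrite negb_imply => /andP[AE /existsPn nt].
have /eqP/cards2P[v [w [vw EA]]] := E2 _ AE.
have [[AF sAF]|[X [tX vX wX]]] := sparse_setU1_or_tight sF vw; last first.
  by have := nt X; rewrite tX EA subUset !sub1set vX wX.
rewrite -EA in AF sAF.
have AFE : A |: F \subset E by rewrite subUset sub1set AE.
apply: (IHn (A |: F)) => //; rewrite cardsU1 AF.
have := subset_leq_card AFE; rewrite cardsU1 AF; card_lia.
Qed.

Definition blocks F := [set X | maxset (tight F) X].

Lemma block_tight F X : X \in blocks F -> tight F X.
Proof. by rewrite inE => /maxsetp. Qed.

Lemma block_unique F X Y : sparse F -> X \in blocks F -> Y \in blocks F ->
  1 < #|X :&: Y| -> X = Y.
Proof.
move=> sF; rewrite !inE => /maxsetP[tX mX] /maxsetP[tY mY] XY.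
have tU := tight_setU sF tX tY XY.
by rewrite -(mX _ tU (subsetUl _ _)) (mY _ tU (subsetUr _ _)).
Qed.

(** Each edge of S lies in exactly one block: two blocks through it would share
    its two ends. *)
Lemma sum_blocks F S : sparse F -> two_uniform S ->
  (forall A, A \in S -> exists2 X, tight F X & A \subset X) ->
  \sum_(X in blocks F) #|induced S X| = #|S|.
Proof.
move=> sF S2 cov; rewrite -sum1_card.
transitivity (\sum_(X in blocks F) \sum_(A in S) (A \subset X)).
  apply: eq_bigr => X _; rewrite -sum1_card big_mkcond [RHS]big_mkcond.
  by apply: eq_bigr => A _; rewrite inE; case: (A \in S); case: (A \subset X).
rewrite exchange_big; apply: eq_bigr => A AS /=.
have [X tX AX] := cov _ AS; have [Y mY XY] := maxset_exists tX.
have AY := subset_trans AX XY.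
have PY : Y \in blocks F by rewrite inE.
rewrite (bigD1 Y) //= AY big1 // => Z /andP[PZ ZY].
apply/eqP; rewrite eqb0; apply: contra ZY => AZ; apply/eqP.
apply: (block_unique sF) => //; rewrite -(S2 _ AS) subset_leq_card //.
by rewrite subsetI AZ.
Qed.

(** Ten times the amount that a vertex with d neighbours inside a block receives
    from it.  The slope 3 and the constant 2 make an edge (5 + 5 = 10) and K5
    minus an edge (16 + 16 + 16 + 11 + 11 = 70) spend exactly ten times
    2|X| - 3; the bonus at d = 4 serves the vertices that belong to one block
    only. *)
Definition charge d := 2 + 3 * d + 2 * (d == 4).

Lemma neighbours_induced_sub E X v :
  neighbours (induced E X) v \subset X :\ v.
Proof.
apply/subsetP=> w; rewrite !inE => /and3P[-> _] /subsetP -> //.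
by rewrite !inE eqxx orbT.
Qed.

Lemma two_uniform_induced E X : two_uniform E -> two_uniform (induced E X).
Proof. by move=> E2 A; rewrite inE => /andP[/E2]. Qed.

Lemma degree_induced_lt E X v : two_uniform E -> v \in X ->
  degree (induced E X) v < #|X|.
Proof.
move=> E2 vX; rewrite degree_neighbours; last exact: two_uniform_induced.
by rewrite (cardsD1 v X) vX ltnS subset_leq_card ?neighbours_induced_sub.
Qed.

Lemma degree_induced_le E X v : degree (induced E X) v <= degree E v.
Proof.
rewrite /degree subset_leq_card //; apply/subsetP=> A.
by rewrite !inE => /andP[/andP[-> _] ->].
Qed.

(** Four vertices of full degree in a five-element set are adjacent to all of
    it, which makes the fifth vertex full as well. *)
Lemma full_vertices_of_five E X v : two_uniform E -> #|X| = 5 -> v \in X ->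
  degree (induced E X) v < 4 ->
  #|[set w in X | degree (induced E X) w == 4]| <= 3.
Proof.
move=> E2 X5 vX; apply: contraTT; rewrite -leqNgt -ltnNge => t4.
have IE2 := two_uniform_induced (X := X) E2.
have XD w : w \in X -> #|X :\ w| = 4.
  by move=> wX; have := cardsD1 w X; rewrite X5 wX; lia.
have [dv|dv] := eqVneq (degree (induced E X) v) 4; first by rewrite dv.
have full w : w \in X :\ v -> degree (induced E X) w = 4.
  have sub : [set w in X | degree (induced E X) w == 4] \subset X :\ v.
    apply/subsetP=> u; rewrite !inE => /andP[-> /eqP du].
    by rewrite andbT; apply: contra dv => /eqP <-; rewrite du.
  have /eqP <- : [set w in X | degree (induced E X) w == 4] == X :\ v.
    by rewrite eqEcard sub XD.
  by rewrite inE => /andP[_ /eqP].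
rewrite degree_neighbours // -(XD v) // subset_leq_card //.
apply/subsetP=> w wXv; have := wXv; rewrite !inE => /andP[wv wX].
rewrite wv /=; have : v \in neighbours (induced E X) w.
  have /eqP -> : neighbours (induced E X) w == X :\ w.
    by rewrite eqEcard neighbours_induced_sub -degree_neighbours // full // XD.
  by rewrite !inE eq_sym wv.
by rewrite !inE setUC => /andP[_].
Qed.

(** Let m = |X|, let t < m count the vertices with four neighbours in X, and
    let s be the sum of the inner degrees.  The charge 2m + 3s + 2t is at most
    11m + 5t since s <= 3m + t, which suffices for m >= 7, and for m = 6 when
    t <= 4.  If m = 6 and t = 5, one unit is gained because s is even.  For
    m = 5 at most three vertices are full, and s <= m(m - 1) together with
    4t <= s settles m <= 4. *)
Lemma charge_block E X v : two_uniform E -> (forall w, degree E w <= 4) ->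
  1 < #|X| -> v \in X -> degree (induced E X) v < 4 ->
  \sum_(w in X) charge (degree (induced E X) w) + 30 <= 20 * #|X|.
Proof.
move=> E2 E4 X1 vX dv; set d := degree (induced E X).
pose T := [set w in X | d w == 4].
have d4 w : d w <= 4 by apply: leq_trans (degree_induced_le _ _ _) (E4 w).
have sumT : \sum_(w in X) (d w == 4 : nat) = #|T|.
  rewrite -sum1_card big_mkcond [RHS]big_mkcond; apply: eq_bigr => w _.
  by rewrite inE; case: (w \in X); case: eqP.
have -> : \sum_(w in X) charge (d w) =
    2 * #|X| + 3 * \sum_(w in X) d w + 2 * #|T|.
  by rewrite (mulnC 2 #|X|) -sum_nat_const -sumT !big_distrr -!big_split.
have TX : #|T| < #|X|.
  apply: proper_card; apply/properP; split.
    by apply/subsetP=> w; rewrite inE => /andP[].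
  by exists v => //; rewrite inE vX /= neq_ltn dv.
have le3 : \sum_(w in X) d w <= 3 * #|X| + #|T|.
  rewrite -sumT mulnC -sum_nat_const -big_split /=; apply: leq_sum => w _.
  by have := d4 w; case: eqP; lia.
have ge4 : 4 * #|T| <= \sum_(w in X) d w.
  by rewrite -sumT big_distrr; apply: leq_sum => w _; case: eqP => [->|].
have leX : \sum_(w in X) d w <= #|X| * #|X|.-1.
  rewrite -sum_nat_const; apply: leq_sum => w wX.
  by have := degree_induced_lt E2 wX; rewrite -/(d w); lia.
have T3 : #|X| = 5 -> #|T| <= 3.
  by move=> X5; apply: (full_vertices_of_five E2 X5 vX dv).
have := handshake X E2; rewrite -/d.
move: (\sum_(w in X) d w) #|T| #|X| #|induced E X| X1 TX le3 ge4 leX T3.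
by move=> s t m k; case: m => [|[|[|[|[|m]]]]] /=; lia.
Qed.

(** A vertex all of whose edges lie in one block receives charge(4) = 16.
    Any other vertex lies in at least two blocks, and receives at least
    2 * 2 + 3 * 4. *)
Lemma charge_vertex E F v : sparse F -> two_uniform E ->
  (forall A, A \in E -> exists2 X, tight F X & A \subset X) ->
  degree E v = 4 ->
  16 <= \sum_(X in blocks F | v \in X) charge (degree (induced E X) v).
Proof.
move=> sF E2 cov d4; pose d X := degree (induced E X) v.
have sumd : \sum_(X in blocks F | v \in X) d X = 4.
  rewrite -[RHS]d4 /degree -(sum_blocks sF (S := star E v)); first last.
  - by move=> A; rewrite inE => /andP[/cov].
  - by move=> A; rewrite inE => /andP[/E2].
  rewrite big_mkcondr; apply: eq_bigr => X _.
  have -> : #|induced (star E v) X| = d X.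
    by apply: eq_card => A; rewrite !inE andbAC.
  case: ifPn => // vX; apply/esym/eqP; rewrite cards_eq0; apply/eqP/setP=> A.
  rewrite !inE; apply/negP=> /andP[/andP[_ /subsetP AX] /AX].
  exact/negP.
have [/existsP[X /and3P[PX vX /eqP dX]]|no4] :=
    boolP [exists X, [&& X \in blocks F, v \in X & d X == 4]].
  by rewrite (bigD1 X) ?PX //= -/(d X) dX.
have dle X : X \in blocks F -> v \in X -> d X <= 3.
  move=> PX vX; have := degree_induced_le E X v; rewrite d4 -/(d X).
  have : d X != 4.
    by apply: contra no4 => dX; apply/existsP; exists X; rewrite PX vX.
  lia.
pose k := \sum_(X in blocks F | v \in X) 1.
have k3 : \sum_(X in blocks F | v \in X) d X <= 3 * k.
  rewrite big_distrr; apply: leq_sum => X /andP[PX vX].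
  by rewrite dle.
have : 2 * k + 3 * \sum_(X in blocks F | v \in X) d X <=
    \sum_(X in blocks F | v \in X) charge (d X).
  rewrite !big_distrr -big_split /=; apply: leq_sum => X _.
  by rewrite /charge muln1 leq_addr.
by apply: leq_trans; rewrite sumd in k3 *; lia.
Qed.

(** The last hypothesis is the form of connectedness that the counting uses: no
    proper nonempty vertex set keeps all four edges of each of its vertices. *)
Lemma large_sparse_subgraph E : two_uniform E -> (forall v, degree E v = 4) ->
  (forall X v, v \in X ->
     (forall w, w \in X -> degree (induced E X) w = 4) -> X = setT) ->
  exists F, [/\ F \subset E, sparse F & 16 * #|V| <= 10 * #|F| + 10].
Proof.
move=> E2 E4 conn.
have s0 : sparse set0.
  split=> [A|X X1]; first by rewrite inE.
  rewrite (_ : induced _ _ = set0) ?cards0; first by lia.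
  by apply/setP=> A; rewrite !inE.
have [F [FE sF cov]] := exists_spanning_sparse E2 (sub0set E) s0.
exists F; split=> //; have F2 := sF.1.
have [/andP[V1 /eqP tT]|ntT] := boolP (tight F setT).
  have /card_gt0P[v _] : 0 < #|[set: V]| by apply: leq_trans V1.
  have V5 : 4 < #|[set: V]|.
    rewrite -(E4 v); apply: leq_ltn_trans (degree_induced_lt E2 (in_setT v)).
    rewrite subset_leq_card //; apply/subsetP=> A.
    by rewrite !inE subsetT andbT.
  have : #|induced F setT| = #|F|.
    by apply: eq_card => A; rewrite inE subsetT andbT.
  move: V5 tT; rewrite cardsT; card_lia.
have EF : \sum_(X in blocks F) (2 * #|X| - 3) = #|F|.
  rewrite -(sum_blocks sF F2) => [|A AF]; last exact: cov (subsetP FE _ AF).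
  apply: eq_bigr => X /block_tight /andP[_ /eqP]; card_lia.
have le1 : 16 * #|V| <=
  \sum_v \sum_(X in blocks F | v \in X) charge (degree (induced E X) v).
  by rewrite mulnC -sum_nat_const; apply: leq_sum => v _; apply: charge_vertex.
have le2 :
  \sum_v \sum_(X in blocks F | v \in X) charge (degree (induced E X) v) <=
  10 * #|F|.
  rewrite -EF big_distrr /= (exchange_big_dep (fun X => X \in blocks F)) //=;
    last by move=> v X _ /andP[].
  apply: leq_sum => X PX; have tX := block_tight PX; have /andP[X1 _] := tX.
  rewrite (eq_bigl (mem X)) => [|v]; last by rewrite PX.
  have [/existsP[v /andP[vX dv]]|all4] :=
      boolP [exists v in X, degree (induced E X) v < 4].
    have := charge_block E2 _ X1 vX dv => /(_ (fun w => eq_leq (E4 w))).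
    move: X1; clear; move: (\sum_(_ in _) _) => s; lia.
  case/negP: ntT; have /card_gt0P[v vX] : 0 < #|X| by apply: leq_trans X1.
  rewrite -(conn X v vX) // => w wX; apply/eqP.
  rewrite eqn_leq -{1}(E4 w) degree_induced_le /= leqNgt.
  by apply: contra all4 => dw; apply/existsP; exists w; rewrite wX.
lia.
Qed.

End EdgeSets.
(** * Stresses and generic configurations *)

Section Rigidity.
Set Implicit Arguments.
Unset Strict Implicit.
Variables (R : realType) (V : finType).
Implicit Types (F : {set {set V}}) (A : {set V}) (v w : V) (p : V -> 'rV[R]_2).
Implicit Types (omega : {set V} -> R).

Definition edge_entry p A v k : R :=
  if v \in A then \sum_(w in A :\ v) (p v - p w) 0 k else 0.

(** Stresses are linear dependencies among the rows of the rigidity matrix.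
    Weights live on all vertex sets, so that one function can serve as a stress of
    several edge sets. *)
Definition stress F p omega := forall v k,
  \sum_(A in F) omega A * edge_entry p A v k = 0.

Definition independent F p := forall omega, stress F p omega ->
  forall A, A \in F -> omega A = 0.

Definition edge_matrix F p : 'M[R]_(#|F|, #|{: V * 'I_2}|) :=
  \matrix_(a, c) edge_entry p (enum_val a) (enum_val c).1 (enum_val c).2.

Lemma rigidity_matrixE (e : rel V) p :
  rigidity_matrix e p = edge_matrix (edges e) p.
Proof. by []. Qed.

Lemma sum_enum_val F (g : {set V} -> R) :
  \sum_(A in F) g A = \sum_(a < #|F|) g (enum_val a).
Proof. exact: big_enum_val. Qed.

Lemma independentP F p : independent F p <-> row_free (edge_matrix F p).
Proof.
split=> [ind|free omega st A AF].
  apply: inj_row_free => u u0; apply/rowP=> a; rewrite [RHS]mxE.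
  pose omega (A : {set V}) :=
    if [pick b : 'I_#|F| | enum_val b == A] is Some b then u 0 b else 0.
  have omegaE b : omega (enum_val b) = u 0 b.
    rewrite /omega; case: pickP => [b' /eqP /enum_val_inj -> //|/(_ b)].
    by rewrite eqxx.
  rewrite -omegaE; apply: (ind _ _ _ (enum_valP a)) => v k.
  move/rowP/(_ (enum_rank (v, k))): u0; rewrite !mxE => u0; rewrite -[RHS]u0.
  rewrite sum_enum_val; apply: eq_bigr => b _.
  by rewrite omegaE !mxE !enum_rankK.
pose u : 'rV_#|F| := \row_a omega (enum_val a).
have u0 : u = 0.
  apply/eqP; rewrite -(mulmx_free_eq0 _ free); apply/eqP/rowP=> c.
  rewrite !mxE -[RHS](st (enum_val c).1 (enum_val c).2).
  rewrite sum_enum_val; apply: eq_bigr => b _.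
  by rewrite !mxE.
move/rowP/(_ (enum_rank_in AF A)): u0.
by rewrite !mxE enum_rankK_in.
Qed.

Lemma independent_rank F F' p : F \subset F' -> independent F p ->
  (#|F| <= \rank (edge_matrix F' p))%N.
Proof.
move=> /subsetP sF /independentP /eqP <-.
apply/mxrankS/row_subP => a.
have aF' := sF _ (enum_valP a).
rewrite (_ : row a _ = row (enum_rank_in aF' (enum_val a)) (edge_matrix F' p)).
  exact: row_sub.
by apply/rowP=> c; rewrite !mxE enum_rankK_in.
Qed.

Definition coordinates p (i : 'I_#|{: V * 'I_2}|) : R :=
  p (enum_val i).1 0 (enum_val i).2.

Notation evaluate p := (mmap (ratr : rat -> R) (coordinates p)).

(** A maximal nonvanishing minor at p0 is the value of a nonzero polynomial with
    rational coefficients, which cannot vanish at algebraically independent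
    coordinates. *)
Lemma generic_rank p0 p m n (M : 'M[{mpoly rat[#|{: V * 'I_2}|]}]_(m, n)) :
  generic p -> (\rank (map_mx (evaluate p0) M) <= \rank (map_mx (evaluate p) M))%N.
Proof.
move=> gp; set M0 := map_mx _ M.
pose f := maxrankfun M0; pose B := rowsub f M0.
have fB : row_full B^T by rewrite /row_full mxrank_tr; exact: maxrowsub_free.
pose g := fullrankfun fB.
have := fullrowsub_unit fB; rewrite unitmxE unitfE => d0.
pose N := mxsub f g M.
have dN : \det N != 0.
  apply: contra d0 => /eqP dN; rewrite -det_tr.
  have -> : (rowsub g B^T)^T = map_mx (evaluate p0) N.
    by apply/matrixP=> i j; rewrite !mxE.
  by rewrite (det_map_mx (evaluate p0 : {rmorphism _ -> _})) dN rmorph0.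
have : \rank (map_mx (evaluate p) N) = \rank M0.
  apply/mxrank_unit; rewrite unitmxE unitfE.
  rewrite (det_map_mx (evaluate p : {rmorphism _ -> _})).
  by apply: contra dN => /eqP /gp ->.
move=> <-; set M1 := map_mx (evaluate p) M.
have -> : map_mx (evaluate p) N = (rowsub g (rowsub f M1)^T)^T.
  by apply/matrixP=> i j; rewrite !mxE.
rewrite mxrank_tr (leq_trans (mxrankS (rowsub_sub _ _))) // mxrank_tr.
exact/mxrankS/rowsub_sub.
Qed.

Lemma evaluateX p (v : V) (k : 'I_2) :
  evaluate p 'X_(enum_rank (v, k)) = p v 0 k.
Proof. by rewrite mmapX mmap1U /coordinates enum_rankK. Qed.

(** This lets independence be proved at a convenient special position. *)
Lemma independent_generic F p0 p : generic p -> independent F p0 ->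
  independent F p.
Proof.
move=> gp /independentP/eqP free0; apply/independentP.
pose X v k : {mpoly rat[#|{: V * 'I_2}|]} := 'X_(enum_rank (v, k)).
pose M : 'M[{mpoly rat[#|{: V * 'I_2}|]}]_(#|F|, #|{: V * 'I_2}|) :=
  \matrix_(a, c) let A : {set V} := enum_val a in
    let v := (enum_val c).1 in let k := (enum_val c).2 in
    if v \in A then \sum_(w in A :\ v) (X v k - X w k) else 0.
have ME q : edge_matrix F q = map_mx (evaluate q) M.
  apply/matrixP=> a c; rewrite !mxE /edge_entry; case: ifP => _.
    rewrite rmorph_sum; apply: eq_bigr => w _.
    by rewrite rmorphB /= !evaluateX !mxE.
  by rewrite rmorph0.
by rewrite -row_leq_rank -{1}free0 !ME generic_rank.
Qed.

Lemma generic_neq0 p0 p (q : {mpoly rat[#|{: V * 'I_2}|]}) : generic p ->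
  evaluate p0 q != 0 -> evaluate p q != 0.
Proof. by move=> gp; apply: contra => /eqP /gp ->; rewrite rmorph0. Qed.

Definition cross (x y : 'rV[R]_2) := x 0 0 * y 0 1 - x 0 1 * y 0 0.

Definition general_position p := injective p /\
  forall u v w, u != v -> u != w -> v != w -> cross (p v - p u) (p w - p u) != 0.

Lemma generic_general_position p : generic p -> general_position p.
Proof.
move=> gp; pose X v k : {mpoly rat[#|{: V * 'I_2}|]} := 'X_(enum_rank (v, k)).
split=> [v w|u v w uv uw vw].
  apply: contra_eq => vw; apply/eqP => /rowP/(_ 0)/eqP; apply/negP.
  rewrite -subr_eq0; pose p0 x : 'rV[R]_2 := \row__ (x == v)%:R.
  (* The polynomial X_v - X_w is nonzero at the configuration p0. *)
  rewrite -!evaluateX -rmorphB (generic_neq0 (p0 := p0)) //.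
  rewrite rmorphB /= !evaluateX !mxE eqxx [w == v]eq_sym.
  by rewrite (negPf vw) subr0 oner_eq0.
(* p0 sends v, w and u to the two unit vectors and the origin. *)
pose p0 x : 'rV[R]_2 := \row_k (x == if k == 0 then v else w)%:R.
pose q := (X v 0 - X u 0) * (X w 1 - X u 1) - (X v 1 - X u 1) * (X w 0 - X u 0).
have qE r : evaluate r q = cross (r v - r u) (r w - r u).
  by rewrite rmorphB !rmorphM /= !rmorphB /= !evaluateX /cross !mxE.
rewrite -qE (generic_neq0 (p0 := p0)) // qE /cross !mxE /= !eqxx.
rewrite (eq_sym w v) (negPf uv) (negPf uw) (negPf vw).
by rewrite !subr0 mulr1 mul0r subr0 oner_eq0.
Qed.

(** * Sparse sets are generically independent *)

Lemma cross_solve (x y : 'rV[R]_2) a b : cross x y != 0 ->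
  (forall k, a * x 0 k + b * y 0 k = 0) -> a = 0 /\ b = 0.
Proof.
move=> xy lin; have := lin 0; have := lin 1 => e1 e0.
have ha : a * cross x y = 0.
  transitivity ((a * x 0 0 + b * y 0 0) * y 0 1
                - (a * x 0 1 + b * y 0 1) * y 0 0);
    first by rewrite /cross; ring.
  by rewrite e0 e1 !mul0r subr0.
have hb : b * cross x y = 0.
  transitivity ((a * x 0 1 + b * y 0 1) * x 0 0
                - (a * x 0 0 + b * y 0 0) * x 0 1);
    first by rewrite /cross; ring.
  by rewrite e0 e1 !mul0r subr0.
move/eqP: ha; move/eqP: hb; rewrite !mulf_eq0 (negPf xy) !orbF.
by move=> /eqP -> /eqP ->.
Qed.

Lemma edge_entry_notin p A v k : v \notin A -> edge_entry p A v k = 0.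
Proof. by rewrite /edge_entry => /negPf ->. Qed.

Lemma eq_edge_entry p q A v k : {in A, p =1 q} ->
  edge_entry p A v k = edge_entry q A v k.
Proof.
move=> pq; rewrite /edge_entry; case: ifP => // vA; apply: eq_bigr => w.
by rewrite inE => /andP[_ wA]; rewrite !pq.
Qed.

Lemma edge_entry_pair p v w x k : v != w ->
  edge_entry p [set v; w] x k =
  if x == v then (p v - p w) 0 k else if x == w then (p w - p v) 0 k else 0.
Proof.
move=> vw; rewrite /edge_entry !inE.
have [->|xv] := eqVneq x v.
  rewrite (_ : [set v; w] :\ v = [set w]) ?big_set1 //.
  apply/setP=> y; rewrite !inE.
  by case: (eqVneq y v) => [->|//]; rewrite (negPf vw).
have [->|//] := eqVneq x w.
rewrite (_ : [set v; w] :\ w = [set v]) ?big_set1 //.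
apply/setP=> y; rewrite !inE.
by case: (eqVneq y w) => [->|_]; rewrite ?orbF // eq_sym (negPf vw).
Qed.

Lemma sum_delete_vertex F v (g : {set V} -> R) : two_uniform F ->
  \sum_(A in F) g A =
  \sum_(A in delete_vertex F v) g A + \sum_(w in neighbours F v) g [set v; w].
Proof.
move=> F2; rewrite (bigID (fun A : {set V} => v \notin A)) /=; congr (_ + _).
  by apply: eq_bigl => A; rewrite inE.
transitivity (\sum_(A in star F v) g A).
  by apply: eq_bigl => A; rewrite inE negbK.
rewrite star_neighbours // big_imset // => x y.
rewrite !inE => /andP[xv _] /andP[yv _]; exact: pair_inj.
Qed.

Lemma stress_at_vertex F p omega v k : two_uniform F -> stress F p omega ->
  \sum_(w in neighbours F v) omega [set v; w] * (p v - p w) 0 k = 0.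
Proof.
move=> F2 /(_ v k); rewrite (sum_delete_vertex v) // big1 ?add0r => [|A].
  move=> s0; rewrite -[RHS]s0; apply: eq_bigr => w; rewrite inE => /andP[wv _].
  by rewrite edge_entry_pair ?eqxx // eq_sym.
by rewrite inE => /andP[_ vA]; rewrite edge_entry_notin ?mulr0.
Qed.

(** Common part of both extension steps that remove v: a stress that vanishes
    around v is a stress of the edges avoiding v. *)
Lemma independent_of_deletion F p v : two_uniform F ->
  independent (delete_vertex F v) p ->
  (forall omega, stress F p omega ->
     forall w, w \in neighbours F v -> omega [set v; w] = 0) ->
  independent F p.
Proof.
move=> F2 ind star0 omega st A AF; have s0 := star0 _ st.
have [vA|vA] := boolP (v \in A); last first.
  apply: ind; last by rewrite inE AF.
  move=> x k; rewrite -[RHS](st x k) [RHS](sum_delete_vertex v) //.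
  rewrite [X in _ + X]big1 ?addr0 // => w wN.
  by rewrite s0 // mul0r.
have : A \in star F v by rewrite inE AF.
by rewrite star_neighbours // => /imsetP[w wN ->]; apply: s0.
Qed.

(** Equilibrium at v is a linear relation between at most two vectors that are
    linearly independent in general position. *)
Lemma zero_extension F p v : two_uniform F -> general_position p ->
  (degree F v <= 2)%N -> independent (delete_vertex F v) p -> independent F p.
Proof.
move=> F2 [p_inj p_cross] dv ind; apply: (independent_of_deletion F2 ind).
move=> omega st; have := fun k => stress_at_vertex v k F2 st.
have nv w : w \in neighbours F v -> v != w by rewrite inE eq_sym => /andP[].
move: dv; rewrite degree_neighbours // => dv.
have [N0|/set0Pn[a aN]] := eqVneq (neighbours F v) set0.
  by move=> _ w; rewrite N0 inE.
have EN := setD1K aN; have dN := cardsD1 a (neighbours F v); rewrite aN in dN.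
have [N1|/set0Pn[b bN]] := eqVneq (neighbours F v :\ a) set0.
  rewrite -EN N1 setU0 => eq0 w /set1P ->; apply/eqP; apply: contraTT (nv a aN).
  move=> w0; rewrite negbK; apply/eqP/p_inj/rowP => k; apply/eqP.
  have := eq0 k; rewrite big_set1 => /eqP.
  by rewrite mulf_eq0 (negPf w0) !mxE subr_eq0.
have N2 : neighbours F v :\ a = [set b].
  by apply/esym/eqP; rewrite eqEcard sub1set bN cards1; lia.
move: bN; rewrite inE in_set1 => /andP[ba bN].
have ab : a != b by rewrite eq_sym.
rewrite -EN N2 => eq0.
have [wa wb] : omega [set v; a] = 0 /\ omega [set v; b] = 0.
  apply: (cross_solve (p_cross v a b (nv a aN) (nv b bN) ab)) => k.
  have := eq0 k; rewrite big_setU1 ?inE //= big_set1 !mxE => eq0k.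
  by apply: oppr_inj; rewrite oppr0 -[RHS]eq0k; ring.
by move=> w /set2P[] ->.
Qed.

Definition move_to_midpoint p v a b : V -> 'rV[R]_2 :=
  fun x => if x == v then 2^-1 *: (p a + p b) else p x.

(** With v at the midpoint of ab, the two edges va and vb act on the rest of the
    framework as the single edge ab: equilibrium at v forces the third edge vc,
    which leaves the line ab, to carry no stress, and va, vb to carry the same
    stress, half of which is the stress on ab. *)
Lemma one_extension F p v a b c : two_uniform F -> general_position p ->
  neighbours F v = [set a; b; c] -> [&& a != b, a != c & b != c] ->
  [set a; b] \notin delete_vertex F v ->
  independent ([set a; b] |: delete_vertex F v) p ->
  independent F (move_to_midpoint p v a b).
Proof.
move=> F2 [_ p_cross] EN /and3P[ab ac bc] abF ind omega st.
set q := move_to_midpoint p v a b in st *.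
have nv w : w \in neighbours F v -> v != w by rewrite inE eq_sym => /andP[].
have va : v != a by rewrite nv // EN !inE eqxx.
have vb : v != b by rewrite nv // EN !inE eqxx orbT.
have vc : v != c by rewrite nv // EN !inE eqxx orbT.
have qv : q v = 2^-1 *: (p a + p b) by rewrite /q /move_to_midpoint eqxx.
have qE w : v != w -> q w = p w.
  by rewrite /q /move_to_midpoint eq_sym => /negPf ->.
have sumN (g : V -> R) : \sum_(w in neighbours F v) g w = g a + g b + g c.
  rewrite EN -setUA !big_setU1 ?inE ?negb_or ?ab ?ac ?bc //= big_set1.
  by rewrite addrA.
set x_a := omega [set v; a]; set x_b := omega [set v; b].
set x_c := omega [set v; c].
have [e_ab x_c0] : (x_a - x_b + x_c) / 2 = 0 /\ - x_c = 0.
  (* Equilibrium at v, in the basis p b - p a, p c - p a. *)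
  apply: (cross_solve (p_cross a b c ab ac bc)) => k.
  have := stress_at_vertex v k F2 st.
  rewrite sumN qv !qE // !mxE -/x_a -/x_b -/x_c => <-; by field.
have {}x_c0 : x_c = 0 by lra.
have {}e_ab : x_b = x_a by lra.
pose omega' A := if A == [set a; b] then x_a / 2 else omega A.
have omega'E A : A \in delete_vertex F v -> omega' A = omega A.
  by rewrite /omega'; case: eqP => // -> /(negP abF).
have st' : stress ([set a; b] |: delete_vertex F v) p omega'.
  move=> x k; have [->|xv] := eqVneq x v.
    apply: big1 => A; rewrite !inE => /orP[/eqP -> | /andP[_ vA]].
      by rewrite edge_entry_notin ?mulr0 // !inE negb_or va vb.
    by rewrite edge_entry_notin ?mulr0.
  rewrite big_setU1 //= -[RHS](st x k)
    [RHS](sum_delete_vertex v) //.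
  rewrite addrC; congr (_ + _).
    apply: eq_bigr => A AH; rewrite omega'E //; congr (_ * _).
    apply: eq_edge_entry => w wA; rewrite qE //; apply: contraTN wA => /eqP <-.
    by move: AH; rewrite inE => /andP[].
  rewrite sumN -/x_a -/x_b -/x_c x_c0 e_ab mul0r addr0 !edge_entry_pair //.
  rewrite (negPf xv) /omega' eqxx qv !qE //.
  have [->|xa] := eqVneq x a; first by rewrite (negPf ab) !mxE; field.
  by case: eqP => _; rewrite ?mxE; field.
have w0 := ind _ st'.
have x_a0 : x_a = 0.
  by have := w0 [set a; b]; rewrite /omega' eqxx setU11 => /(_ isT); lra.
move=> A AF; have [vA|vA] := boolP (v \in A); last first.
  have AH : A \in delete_vertex F v by rewrite inE AF.
  by rewrite -omega'E // w0 // inE AH orbT.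
have : A \in star F v by rewrite inE AF.
rewrite star_neighbours // EN => /imsetP[w].
rewrite !inE -orbA => /or3P[] /eqP -> ->.
- by rewrite -/x_a.
- by rewrite -/x_b e_ab.
- by rewrite -/x_c.
Qed.

(** The independence of one-extensions is obtained at a midpoint configuration
    and then carried back to the generic p. *)
Theorem sparse_independent F p : sparse F -> generic p -> independent F p.
Proof.
move=> sF gp; have pp := generic_general_position gp.
have [n] := ubnP #|F|; elim: n F sF => // n IHn F sF Fn.
have [F0|F0] := eqVneq F set0; first by move=> omega _ A; rewrite F0 inE.
have [v /andP[d0 d3]] := sparse_low_degree sF F0; have F2 := sF.1.
have cF : #|F| = (#|delete_vertex F v| + degree F v)%N.
  rewrite -(cardsID (star F v) F) addnC; congr (_ + _)%N; apply: eq_card => A.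
    by rewrite !inE; case: (A \in F); rewrite ?andbT ?andbF.
  by rewrite !inE; case: (A \in F).
have [d2|d2] := leqP (degree F v) 2.
  apply: (zero_extension F2 pp d2); apply: IHn; last by lia.
  by apply: sparse_sub sF; apply/subsetP=> A; rewrite inE => /andP[].
have {}d3 : degree F v = 3 by lia.
have [a [b [c [EN abc abF sH]]]] := sparse_one_reduction sF d3.
apply: (independent_generic gp (one_extension F2 pp EN abc abF _)).
by apply: IHn => //; rewrite cardsU1 abF; lia.
Qed.

End Rigidity.
(** * Regular connected graphs *)

Section RegularGraphs.
Variables (V : finType) (e : rel V).
Hypothesis simple_e : simple_graph e.

Lemma pair_in_edges v w : ([set v; w] \in edges e) = e v w.
Proof.
have [e_sym e_irr] := simple_e.
apply/idP/idP => [|evw]; last first.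
  by rewrite inE; apply/existsP; exists v; apply/existsP; exists w; rewrite evw /=.
rewrite inE => /existsP[x /existsP[y /andP[exy /eqP Evw]]].
have xy : x != y by apply: contraTneq exy => ->; rewrite e_irr.
have : x \in [set v; w] by rewrite Evw !inE eqxx.
have : y \in [set v; w] by rewrite Evw !inE eqxx orbT.
rewrite !inE => /orP[]/eqP Ey /orP[]/eqP Ex; move: xy exy; rewrite Ex Ey ?eqxx //.
by rewrite e_sym.
Qed.

Lemma two_uniform_edges : two_uniform (edges e).
Proof.
have [_ e_irr] := simple_e.
move=> A; rewrite inE => /existsP[x /existsP[y /andP[exy /eqP ->]]].
by rewrite cards2; case: eqP exy => // ->; rewrite e_irr.
Qed.

Lemma neighbours_edges v : neighbours (edges e) v = [set w | e v w].
Proof.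
have [_ e_irr] := simple_e.
apply: eq_finset => w; rewrite pair_in_edges; case: eqP => // ->.
by rewrite e_irr.
Qed.

Lemma degree_edges d v : valent e d -> degree (edges e) v = d.
Proof.
move=> /(_ v) <-; rewrite degree_neighbours ?neighbours_edges //.
exact: two_uniform_edges.
Qed.

(** Full inner degree makes X closed under adjacency. *)
Lemma connected_full_degree d (X : {set V}) v : connected_graph e -> valent e d ->
  v \in X -> (forall w, w \in X -> degree (induced (edges e) X) w = d) ->
  X = setT.
Proof.
move=> conn val vX full.
have E2 := two_uniform_edges; have I2 := two_uniform_induced (X := X) E2.
have closedX : closed e X.
  apply: intro_closed => [x y|x y exy xX].
    by apply: sym_connect_sym; case: simple_e.
  have EN : neighbours (induced (edges e) X) x = neighbours (edges e) x.
    apply/eqP; rewrite eqEcard -!degree_neighbours // full // (degree_edges _ val).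
    rewrite leqnn andbT; apply/subsetP=> w; rewrite !inE.
    by case/and3P=> -> ->.
  have : y \in neighbours (induced (edges e) X) x.
    by rewrite EN neighbours_edges inE.
  by move/(subsetP (neighbours_induced_sub _ _ _)); rewrite inE => /andP[].
apply/setP=> w; rewrite inE -(closed_connect closedX (conn v w)) //.
Qed.

End RegularGraphs.

Theorem theorem1p1 (R : realType) (V : finType) (e : rel V)
  (simple_e : simple_graph e) (connected_e : connected_graph e)
  (valent_e : valent e 4) (p : V -> 'rV[R]_2) (generic_p : generic p) :
  8%:R / 5%:R * #|V|%:R - 1 <= (rigidity_rank e p)%:R :> R.
Proof.
have [F [FE sF bound]] := large_sparse_subgraph (two_uniform_edges simple_e)
  (fun v => degree_edges simple_e v valent_e)
  (fun X v => connected_full_degree simple_e connected_e valent_e).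
have rankF := independent_rank FE (sparse_independent sF generic_p).
have : (16 * #|V| <= 10 * rigidity_rank e p + 10)%N.
  rewrite /rigidity_rank rigidity_matrixE; lia.
rewrite -(ler_nat R) natrD !natrM; lra.
Qed.
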